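(* Assume that there exist $\Lambda,R,\lambda,\varrho>0$ such that, for all $r\in\mathbb{R}$, $$\lambda\,\chi_{(-\varrho,\varrho)}(r)\le K(r)\le\Lambda\,\chi_{(-R,R)}(r).$$ Let $\kappa\in(0,+\infty)$ and assume that, for every $\omega\in(0,+\infty)$, there is given a solution of $$\partial_t u(x,t)=c\,\partial_x^2u(x,t)+\int_{\mathbb{R}}\big(u(y,t)-\Theta\big)_+\,K(x-y)\,dy,\qquad x\in\mathbb{R},\ t\in\mathbb{R},$$ of the form $u(x,t)=v_\omega(x+\omega t)+\Theta$ for some $v_\omega:\mathbb{R}\to\mathbb{R}$, with $v_\omega(0)=0$ and $v_\omega'(0)=\kappa$. Then, given $\omega_0>0$, there exists $\omega\in(0,\omega_0)$ such that the function $v_\omega$ is not monotone nondecreasing.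
   Context: Here $c\in(0,+\infty)$, $\Theta\in\mathbb{R}$ (with $c,\Theta,K,\kappa$ independent of $\omega$), $r_+:=\max\{r,0\}$, $\chi_A$ is the characteristic function of the set $A$, and $K:\mathbb{R}\to[0,+\infty)$ is a nonnegative measurable function. Solutions are classical: $u$ is continuously differentiable in $t$ and twice continuously differentiable in $x$, so that $v_\omega\in C^2(\mathbb{R})$, and the equation holds pointwise. *)

(* Defs.v *)
From HB Require Import structures.
From mathcomp Require Import all_boot all_order all_algebra.
From mathcomp Require Import all_classical all_reals all_analysis.

Set Implicit Arguments.
Unset Strict Implicit.
Unset Printing Implicit Defensive.

Import Order.TTheory GRing.Theory Num.Theory.
Import numFieldNormedType.Exports.
Local Open Scope classical_set_scope.
Local Open Scope ring_scope.

(* R with the sigma-algebra of the Lebesgue measurable sets (the domain of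
   completed_lebesgue_measure); the canonical sigma-algebra of R itself is the
   Borel one. *)
Notation lebesgueType R := (caratheodory_type ((@wlength R idfun)^*)%mu).

(* Lebesgue sigma-algebra on the domain, Borel sigma-algebra on the codomain. *)
Definition lebesgue_measurable_fun (R : realType) (f : R -> R) : Prop :=
  measurable_fun [set: lebesgueType R] (f : lebesgueType R -> R).

Definition continuously_derivable (R : realType) (n : nat) (f : R -> R) : Prop :=
  (forall i : nat, (i < n)%N -> forall x : R, derivable (derive1n i f) x 1) /\
  continuous (derive1n n f).

(* The equation is stated in \bar R, so that it also asserts the finiteness of
   the integral. *)
Definition classical_solution (R : realType) (c Theta : R) (K : R -> R)
    (u : R -> R -> R) : Prop :=
  [/\ (forall x, continuously_derivable 1 (fun t => u x t)),
      (forall t, continuously_derivable 2 (fun x => u x t)) &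
      forall x t,
        ((derive1 (fun s => u x s) t)%:E =
         (c * derive1n 2 (fun z => u z t) x)%:E +
         \int[@completed_lebesgue_measure R]_(y in [set: lebesgueType R])
            (Num.max (u (y : R) t - Theta) 0 * K (x - (y : R)))%:E)%E].

(* Main.v *)
Require Import Defs.
From mathcomp Require Import all_boot all_order all_algebra.
From mathcomp Require Import all_classical all_reals all_analysis.
From mathcomp Require Import measurable_realfun ring lra.
Import Order.TTheory GRing.Theory Num.Theory.
Import numFieldNormedType.Exports.
Local Open Scope classical_set_scope.
Local Open Scope ring_scope.

(** Why the theorem holds. Suppose that the profile w of a wave of speed omega
    is nondecreasing. It solves omega w' = c w'' + I, where I is the
    convolution of K with the positive part of w. Since w does not decrease,
    the part of the convolution over ]x, x + rho[ alone gives
    I(x) >= lam rho w(x) wherever w(x) >= 0 ([convolution_lower_bound]), so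
    that
      w'' <= (omega / c) w' - (lam rho / c) w.
    The linear equation with these coefficients has characteristic polynomial
    X^2 - (omega / c) X + lam rho / c, with negative discriminant as soon as
    omega^2 < 4 c lam rho: its solutions oscillate. Accordingly w cannot be both
    positive and nondecreasing on a half-line
    ([oscillatory_inequality_not_nondecreasing]): the logarithmic
    derivative q = w' / w satisfies the Riccati inequality
    q' <= - q^2 + (omega / c) q - lam rho / c, whose right-hand side is bounded
    above by a negative constant, so q becomes negative. But w is positive on
    a half-line, because w(0) = 0, w'(0) = kappa > 0 and w is nondecreasing.
    Hence every omega small enough gives a profile that is not monotone. *)

(** The integral of a nonnegative function is a supremum over the simple
    functions below it, and every simple function below f is below g. Stated
    without measurability so that it applies at once to integrands containing
    the reflected translate y |-> K (x - y). *)
Lemma ge0_le_integral_nomeas d (T : measurableType d) (R : realType)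
    (mu : {measure set T -> \bar R}) (f g : T -> \bar R) :
  (forall x, 0 <= f x)%E -> (forall x, f x <= g x)%E ->
  (\int[mu]_x f x <= \int[mu]_x g x)%E.
Proof.
move=> f0 fg.
have g0 x : (0 <= g x)%E by exact: le_trans (f0 x) (fg x).
rewrite !ge0_integralTE//; apply: ereal_sup_le => _ [h hf <-].
by exists h => // x; exact: le_trans (hf x) (fg x).
Qed.

Lemma completed_lebesgue_measure_itvoo (R : realType) (a b : R) : a < b ->
  completed_lebesgue_measure (`]a, b[%classic : set (lebesgueType R)) =
    (b - a)%:E.
Proof.
move=> ab; have := lebesgue_measure_itv `]a, b[; rewrite /= lte_fin ab EFinB.
(* Both measures are the same outer measure, restricted to two sigma-algebras. *)
by [].
Qed.

Lemma nondecreasing_derive1_ge0 (R : realType) (f : R -> R) (x : R) :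
  derivable f x 1 -> {homo f : x y / x <= y} -> 0 <= derive1 f x.
Proof.
move=> df fnd; rewrite derive1E; apply: limr_ge; first exact: df.
near=> h.
have h0 : h != 0 by near: h; exact: nbhs_dnbhs_neq.
rewrite /= [h *: 1]mulr1; have [hlt|hgt|/eqP] := ltgtP h 0.
- apply: mulr_le0; first by rewrite invr_le0 ltW.
  by rewrite subr_le0 fnd// gerDr ltW.
- apply: mulr_ge0; first by rewrite invr_ge0 ltW.
  by rewrite subr_ge0 fnd// lerDr ltW.
- by rewrite (negbTE h0).
Unshelve. all: by end_near. Qed.

(** A Sturm-type comparison in Riccati form: q = f' / f has
    q' <= - q^2 + a q - b = - (q - a / 2)^2 - delta with
    delta = b - a^2 / 4 > 0, so it decreases at least at speed delta and cannot
    remain nonnegative on a half-line. *)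
Lemma oscillatory_inequality_not_nondecreasing (R : realType) (f : R -> R) (a b x0 : R) :
  a ^+ 2 < 4 * b ->
  (forall x, derivable f x 1) -> (forall x, derivable (derive1 f) x 1) ->
  (forall x, x0 <= x -> 0 < f x) -> (forall x, x0 <= x -> 0 <= derive1 f x) ->
  ~ (forall x, x0 <= x -> derive1 (derive1 f) x <= a * derive1 f x - b * f x).
Proof.
move=> ab df ddf f0 f'0 f''le.
pose q x := derive1 f x / f x.
pose dq x := derive1 (derive1 f) x / f x - q x ^+ 2.
pose delta := b - a ^+ 2 / 4.
have delta0 : 0 < delta by rewrite /delta; lra.
have isdq x : x0 <= x -> is_derive x 1 q (dq x).
  move=> x0x; have fx0 := f0 _ x0x; have fxN0 : f x != 0 by rewrite gt_eqF.
  have d1 : is_derive x 1 f (derive1 f x) by rewrite derive1E; exact: derivableP.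
  have d2 : is_derive x 1 (derive1 f) (derive1 (derive1 f) x).
    by rewrite [X in is_derive _ _ _ X]derive1E; exact: derivableP.
  apply: (is_derive_eq (is_deriveM d2 (is_deriveV fxN0 d1))).
  rewrite /dq /q /GRing.scale /=. by field.
have dqle x : x0 <= x -> dq x <= - delta.
  move=> x0x; have fx0 := f0 _ x0x.
  have h : derive1 (derive1 f) x / f x <= a * q x - b.
    rewrite ler_pdivrMr// mulrBl /q -mulrA divfK ?gt_eqF//; exact: f''le.
  rewrite /dq /delta; have := sqr_ge0 (q x - a / 2); lra.
have q0 : 0 <= q x0 by rewrite divr_ge0 ?f'0// ltW// f0.
(* At speed delta, q is at most zero at x0 + q(x0) / delta; the extra unit of
   length makes it strictly negative. *)
pose x1 := x0 + (q x0 / delta + 1).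
have x01 : x0 < x1 by rewrite ltrDl ltr_wpDl// divr_ge0// ltW.
have [||xi] := @MVT R q dq x0 x1 x01.
- by move=> x /[!in_itv]/= /andP[/ltW xx _]; exact: isdq.
- apply: derivable_within_continuous => x /[!in_itv]/= /andP[xx _].
  by have [] := isdq _ xx.
move=> /[!in_itv]/= /andP[/ltW xx _] E.
have : 0 <= q x1 by rewrite divr_ge0 ?f'0 ?ltW ?f0// ltW.
have E2 : delta * (x1 - x0) = q x0 + delta by rewrite /x1; field; rewrite gt_eqF.
have := dqle _ xx; rewrite -(ler_pM2r (_ : 0 < x1 - x0)) ?subr_gt0// -E mulNr E2.
lra.
Qed.

(** Only the y in ]x, x + rho[ are kept: there K(x - y) >= lam, and w(y) >= w(x)
    because w is nondecreasing. *)
Lemma convolution_lower_bound (R : realType) (K w : R -> R) (lam rho x : R) :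
  0 <= lam -> 0 < rho -> (forall r, 0 <= K r) ->
  (forall r, `|r| < rho -> lam <= K r) ->
  {homo w : y z / y <= z} -> 0 <= w x ->
  ((lam * rho * w x)%:E <=
    \int[@completed_lebesgue_measure R]_(y in [set: lebesgueType R])
      (Num.max (w (y : R)) 0 * K (x - (y : R)))%:E)%E.
Proof.
move=> lam0 rho0 K0 Kge wnd wx0.
pose A : set (lebesgueType R) := `]x, x + rho[%classic.
have mA : measurable A by apply: sub_caratheodory; exact: (@measurable_itv R `]x, x + rho[).
have kw0 : 0 <= lam * w x by rewrite mulr_ge0.
have -> : (lam * rho * w x)%:E =
    (\int[@completed_lebesgue_measure R]_y ((lam * w x)%:E * (\1_A y)%:E))%E.
  rewrite ge0_integralZl_EFin//; last exact/measurable_EFinP/measurable_indic.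
  rewrite integral_indic// setIT (_ : _ A = rho%:E).
    by rewrite -EFinM; congr EFin; ring.
  by rewrite [LHS]completed_lebesgue_measure_itvoo ?ltrDl// addrC addKr.
apply: ge0_le_integral_nomeas => y.
  by rewrite -EFinM lee_fin mulr_ge0// indicE ler0n.
rewrite -EFinM lee_fin indicE; have [/set_mem|_] := boolP (y \in A); last first.
  by rewrite mulr0 mulr_ge0// le_max lexx orbT.
rewrite /A /= in_itv/= => /andP[xy yx]; rewrite mulr1 mulrC.
apply: ler_pM => //; first by rewrite le_max wnd// ltW.
by apply: Kge; rewrite distrC ger0_norm ?subr_ge0 1?ltW// ltrBlDl.
Qed.

(** The equation on the line t = 0 already determines the profile. *)
Lemma travelling_wave_profile (R : realType) (c Theta : R) (K w : R -> R)
    (omega : R) :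
  classical_solution c Theta K (fun x t => w (x + omega * t) + Theta) ->
  [/\ forall x, derivable w x 1, forall x, derivable (derive1 w) x 1 &
    forall x, ((omega * derive1 w x)%:E = (c * derive1 (derive1 w) x)%:E +
      \int[@completed_lebesgue_measure R]_(y in [set: lebesgueType R])
        (Num.max (w (y : R)) 0 * K (x - (y : R)))%:E)%E].
Proof.
move=> [_ /(_ 0)[C2 _] eqn].
have wE : (fun x : R => w (x + omega * 0) + Theta) = w \+ cst Theta.
  by apply/funext => x; rewrite mulr0 addr0.
have dw x : derivable w x 1.
  have := C2 0%N isT x; rewrite /= wE => h.
  have -> : w = (w \+ cst Theta) - cst Theta by apply/funext => y /=; rewrite !fctE addrK.
  by apply: derivableB.
have w'E : derive1 (w \+ cst Theta) = derive1 w.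
  by apply/funext => x; rewrite !derive1E deriveD// derive_cst addr0.
split => // [x|x]; first by have := C2 1%N isT x; rewrite /= wE w'E.
have := eqn x 0; rewrite wE /= w'E.
have -> : derive1 (fun s => w (x + omega * s) + Theta) 0 = omega * derive1 w x.
  have d1 : is_derive (x + omega * 0) 1 w (derive1 w x).
    rewrite mulr0 addr0 derive1E; exact: derivableP.
  have d2 : is_derive (0 : R) 1 (fun s => x + omega * s) omega.
    by apply: is_derive_eq; rewrite /GRing.scale /=; ring.
  have d3 := is_deriveD
    (@is_derive1_comp _ w (fun s => x + omega * s) 0 _ _ d1 d2)
    (is_derive_cst Theta (0 : R) (1 : R)).
  by rewrite derive1E [LHS](@derive_val _ _ _ _ _ _ _ d3) addr0 mulrC.
move=> ->; congr (_ + _)%E; apply: eq_integral => y _.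
by rewrite mulr0 addr0 addrK.
Qed.

Theorem theorem2p12 (R : realType) (c Theta : R) (K : R -> R)
    (c_gt0 : 0 < c)
    (K_ge0 : forall r : R, 0 <= K r)
    (K_meas : lebesgue_measurable_fun K)
    (K_bounds : exists Lam Rad lam rho : R,
       [/\ 0 < Lam, 0 < Rad, 0 < lam & 0 < rho] /\
       forall r : R,
         lam * \1_(`](- rho), rho[) r <= K r <= Lam * \1_(`](- Rad), Rad[) r)
    (kappa : R) (kappa_gt0 : 0 < kappa)
    (v : R -> R -> R)
    (v_sol : forall omega : R, 0 < omega ->
       [/\ classical_solution c Theta K
             (fun x t : R => v omega (x + omega * t) + Theta),
           v omega 0 = 0 &
           derive1 (v omega) 0 = kappa])
    (omega0 : R) (omega0_gt0 : 0 < omega0) :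
  exists omega : R, 0 < omega < omega0 /\
    ~ {homo v omega : x y / x <= y}.
Proof.
have [Lam [Rad [lam [rho [[_ _ lam0 rho0] Kb]]]]] := K_bounds.
have Klow r : `|r| < rho -> lam <= K r.
  move=> rrho; have /andP[+ _] := Kb r.
  by rewrite indicE mem_set ?mulr1//= in_itv/= -ltr_norml.
pose m := c * lam * rho.
have m0 : 0 < m by rewrite !mulr_gt0.
(* As omega <= 1 and omega <= m, omega^2 <= omega <= m < 4 m, which is the
   discriminant condition omega^2 < 4 c lam rho. *)
pose omega := Num.min (omega0 / 2) (Num.min 1 m).
have omega_gt0 : 0 < omega by rewrite !lt_min divr_gt0// ltr01.
have omega_le1 : omega <= 1 by rewrite !ge_min lexx orbT.
have omega_lem : omega <= m by rewrite !ge_min lexx !orbT.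
have omega_lt : omega < omega0.
  by rewrite gt_min ltr_pdivrMr// ltr_pMr// ltr1n.
exists omega; split; first by rewrite omega_gt0.
move=> vnd; have [vsol v00 v'0] := v_sol _ omega_gt0.
have [dv ddv veq] := travelling_wave_profile _ _ _ _ _ _ vsol.
have [x0 x0_gt0 vx0] : exists2 x0, 0 < x0 & 0 < v omega x0.
  (* Otherwise v omega <= 0 everywhere, so it is maximal at 0 and kappa = 0. *)
  apply: contrapT => Hn.
  have vle x : v omega x <= 0.
    have [x0|x0] := leP x 0; first by rewrite -v00 vnd.
    by rewrite leNgt; apply/negP => vx; apply: Hn; exists x.
  have [|t _||t _|_ v'00] := @derive1_at_max _ (v omega) (-1) 1 0.
  - by lra.
  - exact: dv.
  - by rewrite in_itv/=; lra.
  - by rewrite v00.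
  by move: kappa_gt0; rewrite -v'0 derive1E v'00 ltxx.
have vpos x : x0 <= x -> 0 < v omega x by move=> /vnd; exact: lt_le_trans.
apply: (@oscillatory_inequality_not_nondecreasing _ (v omega) (omega / c)
  (lam * rho / c) x0) => //.
- rewrite expr_div_n -subr_gt0.
  have -> : 4 * (lam * rho / c) - omega ^+ 2 / c ^+ 2 =
      (4 * m - omega ^+ 2) / c ^+ 2.
    by rewrite /m; field; rewrite gt_eqF.
  rewrite divr_gt0 ?exprn_gt0//.
  have : omega ^+ 2 <= omega * 1 by rewrite expr2 ler_pM2l.
  lra.
- by move=> x _; exact: nondecreasing_derive1_ge0.
move=> x /vpos vx.
have Ile := @convolution_lower_bound _ K (v omega) lam rho x
  (ltW lam0) rho0 K_ge0 Klow vnd (ltW vx).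
have : ((c * derive1 (derive1 (v omega)) x)%:E + (lam * rho * v omega x)%:E <=
        (omega * derive1 (v omega) x)%:E)%E by rewrite veq leeD2l.
rewrite -EFinD lee_fin => le; rewrite -(ler_pM2l c_gt0).
have -> : c * (omega / c * derive1 (v omega) x - lam * rho / c * v omega x) =
   omega * derive1 (v omega) x - lam * rho * v omega x by field; rewrite gt_eqF.
lra.
Qed.
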